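(* Let $n\geq 5$ be an integer. The inertia of the eccentricity matrix $E(W_n)$ of the wheel graph $W_n$ on $n$ vertices is $$\operatorname{In}(E(W_n))=\begin{cases}\left(\frac{n+3}{3},\frac{2n-3}{3},0\right) & \text{if } n\equiv 0\pmod 3,\\[2pt] \left(\frac{n-1}{3},\frac{2n-5}{3},2\right) & \text{if } n\equiv 1\pmod 3,\\[2pt] \left(\frac{n+1}{3},\frac{2n-1}{3},0\right) & \text{if } n\equiv 2\pmod 3.\end{cases}$$
   Context: For a real symmetric matrix $A$, the inertia is $\operatorname{In}(A)=(i_+(A),i_-(A),i_0(A))$, where $i_+(A),i_-(A),i_0(A)$ are the numbers of positive, negative and zero eigenvalues of $A$, counted with multiplicity. For a simple connected graph $G$ with vertices $v_1,\dots,v_n$, let $d(v_i,v_j)$ be the length of a shortest path between $v_i$ and $v_j$, and let $e(v_i)=\max\{d(v_i,v_j):1\le j\le n\}$ be the eccentricity of $v_i$. The eccentricity matrix $E(G)$ is the $n\times n$ real matrix with $(E(G))_{ij}=d(v_i,v_j)$ if $d(v_i,v_j)=\min\{e(v_i),e(v_j)\}$, and $(E(G))_{ij}=0$ otherwise. For $n\ge 4$, the wheel graph $W_n$ is the graph on $n$ vertices consisting of a cycle of length $n-1$ together with one further vertex (the hub) adjacent to every vertex of the cycle. The vertices are labelled so that $v_1$ is the hub and $v_2,\dots,v_n$ are the cycle vertices in cyclic order. *)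

(* Defs.v *)
From mathcomp Require Import all_boot all_order all_algebra.
From mathcomp Require Import reals.
From mathcomp.real_closed Require Import polyrcf.

Set Implicit Arguments.
Unset Strict Implicit.
Unset Printing Implicit Defensive.

Import Order.TTheory GRing.Theory Num.Theory.

Local Open Scope ring_scope.

Record cgraph (T : finType) := CGraph {
  adj :> rel T;
  adj_sym : symmetric adj;
  adj_irr : irreflexive adj;
  adj_connected : forall x y, connect adj x y }.

Section Distance.
Variables (T : finType) (G : cgraph T).

(* walk x y k: y is reached from x by a walk with k edges; the least such k
   is the length of a shortest path. *)
Definition walk (x y : T) (k : nat) : bool :=
  [exists p : k.-tuple T, path G x p && (last x p == y)].

Lemma walk_ex x y : exists k, walk x y k.
Proof.
have /connectP [p Gp ->] := adj_connected G x y.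
by exists (size p); apply/existsP; exists (in_tuple p); rewrite Gp eqxx.
Qed.

Definition dist (x y : T) : nat := ex_minn (walk_ex x y).

Definition ecc (x : T) : nat := (\max_(y : T) dist x y)%N.

End Distance.

Definition ecc_mx (R : pzRingType) (n : nat) (G : cgraph 'I_n) : 'M[R]_n :=
  \matrix_(i, j)
    if dist G i j == minn (ecc G i) (ecc G j) then (dist G i j)%:R else 0.

(* The number of roots of char_poly A satisfying P, with algebraic
   multiplicity; rootsR lists each root in R once. Only roots in R are counted,
   which is all of them when A is symmetric. *)
Definition eigen_count (R : rcfType) (n : nat) (A : 'M[R]_n) (P : pred R) : nat :=
  (\sum_(x <- rootsR (char_poly A) | P x) mup x (char_poly A))%N.

Definition inertia (R : rcfType) (n : nat) (A : 'M[R]_n) : nat * nat * nat :=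
  (eigen_count A (fun x => 0 < x),
   eigen_count A (fun x => x < 0),
   eigen_count A (fun x => x == 0)).

(* Vertex i : 'I_n is the vertex v_(i+1): the hub is 0 and the rim is the cycle
   1, 2, ..., n-1, closed by the edge {n-1, 1}. *)
Definition rim_next (n i j : nat) : bool :=
  ((j == i.+1) || (i == n.-1) && (j == 1))%N.

Definition wheel_adj (n : nat) : rel 'I_n := fun i j =>
  (i != j) &&
  [|| val i == 0, val j == 0, rim_next n i j | rim_next n j i]%N.

Lemma wheel_sym n : symmetric (@wheel_adj n).
Proof.
move=> i j; rewrite /wheel_adj eq_sym orbCA; congr (_ && (_ || (_ || _))).
by rewrite orbC.
Qed.

Lemma wheel_irr n : irreflexive (@wheel_adj n).
Proof. by move=> i; rewrite /wheel_adj eqxx. Qed.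

Lemma wheel_connected n (i j : 'I_n) : connect (@wheel_adj n) i j.
Proof.
case: n i j => [[]//|n] i j.
have hub k : connect (@wheel_adj n.+1) k ord0.
  have [->//|k0] := eqVneq k ord0.
  by apply: connect1; rewrite /wheel_adj k0 /= orbT.
apply: connect_trans (hub i) _.
by rewrite (sym_connect_sym (@wheel_sym _)).
Qed.

Definition wheel (n : nat) : cgraph 'I_n :=
  CGraph (@wheel_sym n) (@wheel_irr n) (@wheel_connected n).

(* Main.v *)
(** With m = n - 1 rim vertices, E(W_n) has hub row (0, 1, ..., 1) and rim block
    2 (J - I - C), where C is the adjacency matrix of the cycle. It is
    diagonalized by real orthogonal vectors. For 0 < k < m the vector with hub
    entry 0 and rim entries cas(2 pi k j / m), where cas = cos + sin, has
    eigenvalue -2 (1 + 2 cos(2 pi k / m)) = -2 sin(3a) / sin(a) with a = pi k / m,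
    whose sign depends only on the position of 3k relative to m and 2m. The two
    remaining eigenvectors are (m, x, ..., x) for the two roots x, one positive
    and one negative, of x^2 = 2 (m - 3) x + m. *)
Require Import Defs.
From mathcomp Require Import all_boot all_order all_algebra.
From mathcomp Require Import reals trigo.
From mathcomp.real_closed Require Import polyrcf.
From mathcomp Require Import zify ring lra.

Set Implicit Arguments.
Unset Strict Implicit.
Unset Printing Implicit Defensive.

Import Order.TTheory GRing.Theory Num.Theory.

Local Open Scope ring_scope.

(** * Inertia from an orthogonal eigenbasis *)

(** Over polynomials, (X I - A) P = P (X I - D). Taking determinants, det P stays nonzero as a
    constant polynomial and cancels. *)
Lemma char_poly_eigenbasis (F : fieldType) n (A P : 'M[F]_n) (d : 'rV[F]_n) :
  P \in unitmx -> A *m P = P *m diag_mx d ->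
  char_poly A = \prod_i ('X - (d 0 i)%:P).
Proof.
move=> Pu AP.
have -> : \prod_i ('X - (d 0 i)%:P) = char_poly (diag_mx d).
  rewrite char_poly_trig ?diag_mx_is_trig//; apply: eq_bigr => i _.
  by rewrite mxE eqxx.
have PX_neq0 : \det (map_mx polyC P) != 0.
  by rewrite det_map_mx polyC_eq0 -unitfE -unitmxE.
apply: (mulIf PX_neq0); rewrite [RHS]mulrC /char_poly -!det_mulmx.
congr (\det _); rewrite /char_poly_mx mulmxBl mulmxBr -!map_mxM AP.
by rewrite mul_scalar_mx mul_mx_scalar.
Qed.

(** The boolean equation says both that distinct columns are orthogonal and that no column is
    isotropic. The Gram matrix is thus diagonal with nonzero entries, and its determinant is the
    square of det P. *)
Lemma unitmx_orthogonal_columns (F : fieldType) n (P : 'M[F]_n) :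
  (forall k l, (\sum_i P i k * P i l == 0) = (k != l)) -> P \in unitmx.
Proof.
move=> orthoP; have PP : P^T *m P = diag_mx (\row_k \sum_i P i k * P i k).
  apply/matrixP => k l; rewrite !mxE; under eq_bigr do rewrite !mxE.
  by case: eqVneq => [->|klN]; [rewrite mulr1n | apply/eqP; rewrite orthoP klN].
have : \det (P^T *m P) != 0.
  rewrite PP det_diag; apply/prodf_neq0 => k _.
  by rewrite mxE orthoP eqxx.
by rewrite det_mulmx det_tr mulf_eq0 orbb unitmxE unitfE.
Qed.

Lemma eigen_countE (R : rcfType) n (A : 'M[R]_n) (s : seq R) (P : pred R) :
  char_poly A = \prod_(x <- s) ('X - x%:P) -> eigen_count A P = count P s.
Proof.
move=> As; rewrite /eigen_count As; set r := rootsR _.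
have r_uniq : uniq r by exact: uniq_roots.
have sr : {subset s <= r}.
  move=> x xs; rewrite /r -roots_on_rootsR ?monic_neq0 ?monic_prod_XsubC//.
  by rewrite root_prod_XsubC xs in_itv.
under eq_bigr do rewrite mu_prod_XsubC.
(* The root list is generalized to any duplicate-free list containing [s], so that it can stay fixed
   while [s] shrinks in the induction. *)
rewrite {As}; move: r_uniq sr; move: r => r r_uniq; elim: s => [|y s IHs] sr.
  by rewrite big1.
have /IHs {IHs} : {subset s <= r} by move=> x xs; rewrite sr// inE xs orbT.
rewrite /= => <-; rewrite big_split/=; congr (_ + _)%N.
have yr : y \in r by rewrite sr// inE eqxx.
rewrite big_mkcond (bigD1_seq y)//= eqxx big1 ?addn0; first by case: (P y).
by move=> x xNy; rewrite eq_sym (negbTE xNy); case: ifP.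
Qed.

(** * Distances, eccentricities and entries of the matrix *)

Lemma walk0 (T : finType) (G : cgraph T) x y : walk G x y 0 = (x == y).
Proof.
apply/existsP/eqP => [[p]|->]; last by exists [tuple] => /=.
by rewrite [p]tuple0 => /eqP.
Qed.

Lemma walk1 (T : finType) (G : cgraph T) x y : walk G x y 1 = G x y.
Proof.
apply/existsP/idP => [[p]|xy]; last by exists [tuple y] => /=; rewrite xy /=.
by case/tupleP: p => z p; rewrite [p]tuple0 /= andbT => /andP[xz /eqP <-].
Qed.

Lemma walk2 (T : finType) (G : cgraph T) x z y : G x z -> G z y -> walk G x y 2.
Proof. by move=> xz zy; apply/existsP; exists [tuple z; y]; rewrite /= xz zy /=. Qed.

Lemma wheel_adjE m (i j : 'I_m.+1) : wheel_adj i j =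
  (i != j :> nat) && [|| i == 0 :> nat, j == 0 :> nat,
    rim_next m.+1 i j | rim_next m.+1 j i]%N.
Proof. by []. Qed.

Lemma dist_wheel m (i j : 'I_m.+1) :
  dist (wheel m.+1) i j = (if i == j :> nat then 0 else if wheel_adj i j then 1 else 2)%N.
Proof.
rewrite /dist; case: ex_minnP => k wk kmin.
have kE l : walk (wheel m.+1) i j l ->
    (forall l', (l' < l)%N -> ~~ walk (wheel m.+1) i j l') ->
    k = l.
  move=> wl Nwl; apply/eqP; rewrite eqn_leq kmin//= leqNgt.
  by apply/negP => /Nwl; rewrite wk.
case: (boolP (i == j :> nat)) => ij; first by apply: kE => //; rewrite walk0.
case: (boolP (wheel_adj i j)) => aij; apply: kE.
- by rewrite walk1.
- by case=> // _; rewrite walk0.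
(* Distinct non-adjacent vertices both lie on the rim, so the hub joins them by two edges. *)
- move: aij; rewrite /wheel_adj ij /= !negb_or => /and4P[i0 j0 _ _].
  by apply: (@walk2 _ _ i ord0 j); rewrite /= /wheel_adj /= ?i0 1?eq_sym ?j0 ?orbT.
- by case=> [|[|//]] _; rewrite ?walk0 ?walk1.
Qed.

Lemma ecc_wheel m (i : 'I_m.+1) : (4 <= m)%N ->
  ecc (wheel m.+1) i = (if i == 0 :> nat then 1 else 2)%N.
Proof.
move=> m4.
have eccE l : (forall j, dist (wheel m.+1) i j <= l)%N ->
    (exists2 j, (j <= m)%N & dist (wheel m.+1) i (inord j) = l) -> ecc (wheel m.+1) i = l.
  move=> le_l [j _ jl]; apply/eqP; rewrite eqn_leq -{2}jl leq_bigmax andbT.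
  by apply/bigmax_leqP.
case: eqVneq => [i0|i0]; apply: eccE.
- by move=> j; rewrite dist_wheel wheel_adjE i0 eq_sym; case: eqVneq.
- exists 1%N; first lia.
  by rewrite dist_wheel wheel_adjE /= inordK ?i0//; lia.
- by move=> j; rewrite dist_wheel; case: ifP => //; case: ifP.
(* A rim vertex two steps away without wrapping around. Since m >= 4, the two vertices are not
   joined by the closing edge {m, 1} either, and i - 2 is not the hub. *)
exists (if (i + 2 <= m)%N then i + 2 else i - 2)%N; first by case: ifP; have := ltn_ord i; lia.
rewrite dist_wheel wheel_adjE /rim_next/= inordK; last by case: ifP; have := ltn_ord i; lia.
by have := ltn_ord i; do !case: ifPn => //; lia.
Qed.

Definition rim_succ (m i : nat) : nat := (if i == m then 1 else i.+1)%N.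
Definition rim_pred (m i : nat) : nat := (if i == 1 then m else i.-1)%N.

(** Between rim vertices both eccentricities are 2, so the entry survives exactly at distance 2.
    Writing it with Kronecker deltas makes the action on a vector a total sum minus three terms. *)
Lemma ecc_mx_wheelE (R : pzRingType) m (i j : 'I_m.+1) : (4 <= m)%N ->
  ecc_mx R (wheel m.+1) i j =
    if i == 0 :> nat then (j != 0 :> nat)%:R else if j == 0 :> nat then 1
    else 2 - 2 * ((j == i :> nat)%:R + (j == rim_succ m i :> nat)%:R
                   + (j == rim_pred m i :> nat)%:R).
Proof.
move=> m4; rewrite mxE dist_wheel !ecc_wheel// wheel_adjE /=.
case: (eqVneq (nat_of_ord i) 0%N) => [->|i0] /=.
  by case: (eqVneq (nat_of_ord j) 0%N) => [_|j0]; rewrite // eq_sym (negbTE j0).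
case: (eqVneq (nat_of_ord j) 0%N) => [->|j0] /=.
  by rewrite (negbTE i0).
(* For m >= 4 the vertex and its two neighbours are distinct; the guards on the right make the three
   deltas visibly exclusive. *)
have [-> -> ->] : [/\ (j == i :> nat) = (i == j :> nat),
    (j == rim_succ m i :> nat) = (i != j :> nat) && rim_next m.+1 i j &
    (j == rim_pred m i :> nat) = [&& i != j :> nat, ~~ rim_next m.+1 i j & rim_next m.+1 j i]].
  rewrite /rim_succ /rim_pred /rim_next; have := ltn_ord i; have := ltn_ord j.
  by do 2!case: ifP; split; lia.
by case: (i == j :> nat); case: rim_next; case: rim_next => //=;
  rewrite ?addr0 ?add0r ?mulr1 ?mulr0 ?subr0 ?subrr.
Qed.

(** * Trigonometric sums and the [cas] kernel *)

(** Telescoping of 2 sin a cos (2 a j) = sin ((2 j + 1) a) - sin ((2 j - 1) a); the sine sum below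
    telescopes in the same way. *)
Lemma sum_cos_telescope (R : realType) (a : R) m :
  2 * sin a * (\sum_(i < m) cos (2 * a * i.+1%:R)) = sin (2 * a * m%:R + a) - sin a.
Proof.
elim: m => [|m IHm]; first by rewrite big_ord0 mulr0 mulr0 add0r subrr.
rewrite big_ord_recr/= mulrDr IHm.
have -> : 2 * a * m%:R + a = 2 * a * m.+1%:R - a by rewrite -natr1; ring.
by rewrite sinB [sin (_ + a)]sinD; ring.
Qed.

Lemma sum_sin_telescope (R : realType) (a : R) m :
  2 * sin a * (\sum_(i < m) sin (2 * a * i.+1%:R)) = cos a - cos (2 * a * m%:R + a).
Proof.
elim: m => [|m IHm]; first by rewrite big_ord0 mulr0 mulr0 add0r subrr.
rewrite big_ord_recr/= mulrDr IHm.
have -> : 2 * a * m%:R + a = 2 * a * m.+1%:R - a by rewrite -natr1; ring.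
by rewrite cosB [cos (_ + a)]cosD; ring.
Qed.

Lemma sum_cos_eq0 (R : realType) (a : R) m : sin a != 0 ->
  sin (2 * a * m%:R) = 0 -> cos (2 * a * m%:R) = 1 ->
  \sum_(i < m) cos (2 * a * i.+1%:R) = 0.
Proof.
move=> sa0 s0 c1; have sa2 : 2 * sin a != 0 by rewrite mulf_neq0 ?pnatr_eq0.
apply: (mulfI sa2).
by rewrite sum_cos_telescope sinD s0 c1 mulr0; ring.
Qed.

Lemma sum_sin_eq0 (R : realType) (a : R) m :
  sin (2 * a * m%:R) = 0 -> cos (2 * a * m%:R) = 1 ->
  \sum_(i < m) sin (2 * a * i.+1%:R) = 0.
Proof.
have [sa0 _ _|sa0 s0 c1] := eqVneq (sin a) 0.
  (* When sin a = 0 the telescoped identity cannot be divided, but each sin (2 a j) is already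
     zero. *)
  rewrite big1// => i _; move: i.+1 => {i}n.
  suff : sin (a * n%:R) = 0.
    by rewrite -mulrA mulr2n mulrDl mul1r -mulr2n sin_mulr2n => ->; rewrite mulr0 mul0rn.
  elim: n => [|n IHn]; first by rewrite mulr0 sin0.
  by rewrite -natr1 mulrDr mulr1 sinD IHn sa0 mulr0 mul0r addr0.
have sa2 : 2 * sin a != 0 by rewrite mulf_neq0 ?pnatr_eq0.
apply: (mulfI sa2).
by rewrite sum_sin_telescope cosD s0 c1 mulr0; ring.
Qed.

(** The kernel of the discrete Hartley transform, a real substitute for the complex characters of
    Z/m. *)
Definition cas (R : realType) (x : R) : R := cos x + sin x.

(** The angle 2 pi k / m, kept as twice a half-angle so that the telescoping sums apply with a = pi
    k / m. *)
Definition rim_angle (R : realType) (m k : nat) : R := 2 * (pi * k%:R / m%:R).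

Lemma rim_angle_period (R : realType) m k : (0 < m)%N ->
  rim_angle R m k * m%:R = pi *+ 2 *+ k.
Proof.
move=> m0; have mN0 : m%:R != 0 :> R by rewrite pnatr_eq0 -lt0n.
by rewrite /rim_angle -mulrnA -[RHS]mulr_natr natrM; field.
Qed.

Lemma casDperiod (R : realType) m k (x : R) : (0 < m)%N ->
  cas (x + rim_angle R m k * m%:R) = cas x.
Proof.
move=> m0; rewrite /cas rim_angle_period//.
by rewrite (periodicn (@cosD2pi R)) (periodicn (@sinD2pi R)).
Qed.

(** Both cos and sin satisfy this identity with the same factor 2 cos t, which makes the [cas]
    vectors eigenvectors of the cycle. *)
Lemma cas_neighbours (R : realType) (x t : R) :
  cas (x + t) + cas (x - t) = 2 * cos t * cas x.
Proof. by rewrite /cas !cosD !sinD cosN sinN; ring. Qed.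

Lemma sin_rim_period (R : realType) m k : (0 < m)%N ->
  sin (rim_angle R m k * m%:R) = 0.
Proof.
by move=> m0; rewrite rim_angle_period// -[X in sin X]add0r (periodicn (@sinD2pi R)) sin0.
Qed.

Lemma cos_rim_period (R : realType) m k : (0 < m)%N ->
  cos (rim_angle R m k * m%:R) = 1.
Proof.
by move=> m0; rewrite rim_angle_period// -[X in cos X]add0r (periodicn (@cosD2pi R)) cos0.
Qed.

Lemma sin_frac_gt0 (R : realType) m d : (0 < d < m)%N ->
  0 < sin (pi * d%:R / m%:R) :> R.
Proof.
case/andP=> d0 dm; have m0 : (0 < m)%N by exact: leq_trans dm.
apply: sin_gt0_pi; rewrite divr_gt0 ?mulr_gt0 ?pi_gt0 ?ltr0n//=.
by rewrite ltr_pdivrMr ?ltr0n// ltr_pM2l ?pi_gt0// ltr_nat.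
Qed.

(** From cas x cas y = cos (x - y) + sin (x + y): the sine part always sums to 0, while the cosine
    part sums to m or 0 according to whether m divides k - l. *)
Lemma sum_cas_cas (R : realType) m k l : (k <= m)%N -> (l <= m)%N -> (0 < m)%N ->
  \sum_(i < m) cas (rim_angle R m k * i.+1%:R) * cas (rim_angle R m l * i.+1%:R)
  = if (k == l %[mod m])%N then m%:R else 0.
Proof.
wlog lk : k l / (l <= k)%N => [wlog_lk km lm m0|km _ m0].
  case/orP: (leq_total l k) => [lk|kl]; first exact: wlog_lk.
  by rewrite eq_sym -wlog_lk//; apply: eq_bigr => i _; rewrite mulrC.
have mN0 : m%:R != 0 :> R by rewrite pnatr_eq0 -lt0n.
pose a : R := pi * (k - l)%:R / m%:R; pose b : R := pi * (k + l)%:R / m%:R.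
have aE x : 2 * a * x = rim_angle R m (k - l) * x by [].
have bE x : 2 * b * x = rim_angle R m (k + l) * x by [].
transitivity (\sum_(i < m) cos (2 * a * i.+1%:R) + \sum_(i < m) sin (2 * b * i.+1%:R)).
  rewrite -big_split/=; apply: eq_bigr => i _.
  have -> : 2 * a * i.+1%:R = rim_angle R m k * i.+1%:R - rim_angle R m l * i.+1%:R.
    by rewrite /a /rim_angle natrB//; ring.
  have -> : 2 * b * i.+1%:R = rim_angle R m k * i.+1%:R + rim_angle R m l * i.+1%:R.
    by rewrite /b /rim_angle natrD; ring.
  by rewrite cosB sinD /cas; ring.
rewrite (@sum_sin_eq0 _ b) ?bE ?cos_rim_period ?sin_rim_period// addr0.
case: ifPn => [|klN].
  rewrite eqn_mod_dvd// => /dvdnP[q klE].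
  rewrite (eq_bigr (fun=> 1)) ?sumr_const ?card_ord// => i _.
  have -> : 2 * a * i.+1%:R = 0 + pi *+ 2 *+ (q * i.+1).
    by rewrite /a klE -mulrnA -[in RHS]mulr_natr !natrM; field.
  by rewrite (periodicn (@cosD2pi R)) cos0.
apply: sum_cos_eq0; rewrite ?aE ?cos_rim_period ?sin_rim_period//.
(* Non-congruence excludes k - l = 0 and k - l = m, so the half-angle lies strictly between 0 and
   pi. *)
rewrite gt_eqF// sin_frac_gt0// lt0n ltn_neqAle leq_subLR (leq_trans km) ?leq_addl// andbT.
by move: klN; rewrite eqn_mod_dvd//; apply: contraR; rewrite negb_and !negbK => /orP[] /eqP->.
Qed.

(** * Signs of the eigenvalues *)

Lemma rim_eigenvalue_sign (R : realType) m k (x := - 2 * (1 + 2 * cos (rim_angle R m k))) :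
  (0 < k < m)%N ->
  [/\ (0 < x) = (m < 3 * k < 2 * m)%N,
      (x < 0) = ((3 * k < m) || (2 * m < 3 * k))%N &
      (x == 0) = ((3 * k == m) || (3 * k == 2 * m))%N].
Proof.
move=> km; have m0 : (0 < m)%N by lia.
have mN0 : m%:R != 0 :> R by rewrite pnatr_eq0 -lt0n.
pose y : R := pi * k%:R / m%:R.
have sx : 0 < sin y by exact: sin_frac_gt0.
(* sin (3 y) = sin y (1 + 2 cos (2 y)) *)
have sg_x : Num.sg x = - Num.sg (sin (y + y + y)).
  rewrite /x -[LHS]mulr1 -[X in _ * X](gtr0_sg sx) -sgrM -sgrN -[RHS]mul1r.
  rewrite -[X in _ = X * _](@gtr0_sg R 2)// -sgrM; congr Num.sg.
  have -> : rim_angle R m k = y + y by rewrite /y /rim_angle; ring.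
  rewrite !sinD !cosD; have := cos2Dsin2 y; move: (cos y) (sin y) => c s cs.
  have cc : c * c = 1 - s * s by rewrite -cs; ring.
  have -> : (s * c + c * s) * c = 2 * s * (c * c) by ring.
  by rewrite cc; ring.
(* Here 3 y = pi (3 k) / m. Removing q half-turns contributes (-1)^q and leaves the angle pi r / m,
   whose sine is positive for 0 < r < m and zero for r = 0. *)
have sinE q r : (3 * k = q * m + r)%N -> sin (y + y + y) = (-1) ^+ q * sin (pi * r%:R / m%:R).
  move=> E; have -> : y + y + y = pi * r%:R / m%:R + pi *+ q.
    have -> : y + y + y = pi * (3 * k)%:R / m%:R by rewrite /y natrM; field.
    by rewrite E -[pi *+ q]mulr_natr natrD natrM; field.
  elim: q {E} => [|q IHq]; first by rewrite mulr0n addr0 mul1r.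
  by rewrite mulrSr addrA sinDpi IHq exprS mulN1r mulNr.
have sgE q r : (3 * k = q * m + r)%N -> (0 < r < m)%N -> Num.sg (sin (y + y + y)) = (-1) ^+ q.
  by move=> E rm; rewrite (sinE _ _ E) sgrM (gtr0_sg (sin_frac_gt0 R rm)) mulr1 sgrX sgrN1.
have sg0 q : (3 * k = q * m)%N -> Num.sg (sin (y + y + y)) = 0.
  by move=> E; rewrite (sinE q 0) ?addn0// mulr0 mul0r sin0 mulr0 sgr0.
have [N11 N10 O01 O10] : [/\ (-1 == 1 :> R) = false, (-1 == 0 :> R) = false,
   (0 == 1 :> R) = false & (1 == 0 :> R) = false].
  by split; apply/eqP => ?; lra.
have O1N : (0 == -1 :> R) = false by rewrite eq_sym.
have I1N : (1 == -1 :> R) = false by rewrite eq_sym.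
rewrite -(sgr_cp0 x).1.1 -(sgr_cp0 x).1.2 -(sgr_cp0 x).2 sg_x.
case: (ltngtP (3 * k) m) => [lt1|gt1|eq1].
- rewrite (sgE 0 (3 * k)%N) ?expr0 ?N11 ?N10 ?eqxx; [|lia..].
  by split=> //; clear -lt1; lia.
- case: (ltngtP (3 * k) (2 * m)) => [lt2|gt2|eq2].
  + by rewrite (sgE 1 (3 * k - m)%N) ?expr1 ?opprK ?eqxx ?I1N ?O10//; lia.
  + by rewrite (sgE 2 (3 * k - 2 * m)%N) ?sqrrN ?expr1n ?eqxx ?N11 ?N10//; lia.
  + by rewrite (sg0 2) ?oppr0 ?eqxx ?O01 ?O1N.
- rewrite (sg0 1) ?mul1n// oppr0 eqxx O01 O1N eq1; split=> //; clear -m0; lia.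
Qed.

(** On (m, x, ..., x) the hub row gives m x, so the eigenvalue is x; a rim row gives m + 2 (m - 3)
    x, which must equal x^2. The flag [b] picks the sign of the square root. *)
Definition hub_root (R : rcfType) (m : nat) (b : bool) : R :=
  (m%:R - 3) + (-1) ^+ b * Num.sqrt ((m%:R - 3) ^+ 2 + m%:R).

Lemma sqr_hub_root (R : rcfType) m b :
  hub_root R m b ^+ 2 = 2 * (m%:R - 3) * hub_root R m b + m%:R.
Proof.
have : Num.sqrt ((m%:R - 3) ^+ 2 + m%:R) ^+ 2 = (m%:R - 3) ^+ 2 + m%:R :> R.
  by rewrite sqr_sqrtr// addr_ge0 ?sqr_ge0.
rewrite /hub_root; move: (Num.sqrt _) => s sE.
by case: b; rewrite ?expr0 ?expr1; apply/eqP; rewrite -subr_eq0; apply/eqP;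
  transitivity (s ^+ 2 - ((m%:R - 3) ^+ 2 + m%:R));
  [ring|rewrite sE subrr|ring|rewrite sE subrr].
Qed.

(** The product of the roots, used twice: it forces them to have opposite signs and makes the two
    hub eigenvectors orthogonal. *)
Lemma hub_root_mul (R : rcfType) m b : hub_root R m b * hub_root R m (~~ b) = - m%:R.
Proof.
have : Num.sqrt ((m%:R - 3) ^+ 2 + m%:R) ^+ 2 = (m%:R - 3) ^+ 2 + m%:R :> R.
  by rewrite sqr_sqrtr// addr_ge0 ?sqr_ge0.
rewrite /hub_root; move: (Num.sqrt _) => s sE.
transitivity ((m%:R - 3) ^+ 2 - s ^+ 2); last by rewrite sE; ring.
by case: b => /=; rewrite ?expr0 ?expr1; ring.
Qed.

Lemma sgr_hub_root (R : rcfType) m b : (0 < m)%N -> Num.sg (hub_root R m b) = (-1) ^+ b.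
Proof.
move=> m0.
have r_gt : hub_root R m true < hub_root R m false.
  rewrite /hub_root ltrD2l expr0 expr1 mulN1r mul1r gtrN// sqrtr_gt0.
  by rewrite ltr_wpDl ?sqr_ge0 ?ltr0n.
have prod_lt0 : hub_root R m true * hub_root R m false < 0.
  by rewrite hub_root_mul oppr_lt0 ltr0n.
have rt_lt0 : hub_root R m true < 0.
  rewrite ltNge; apply/negP => rt_ge0; move: prod_lt0.
  by rewrite ltNge mulr_ge0// (le_trans rt_ge0) ?ltW.
by case: b; [rewrite ltr0_sg | rewrite gtr0_sg// -(nmulr_rlt0 _ rt_lt0)].
Qed.

(** * Eigenvectors and the characteristic polynomial *)

Definition wheel_eigenvalue (R : realType) (m k : nat) : R :=
  if k == 0%N then hub_root R m false else if k == m then hub_root R m true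
  else - 2 * (1 + 2 * cos (rim_angle R m k)).

(* Both k = 0 and k = m satisfy m %| k; there cas is constantly 1 on the rim,
   which gives the two eigenvectors that do not vanish on the hub. *)
Definition wheel_eigenvector (R : realType) (m k i : nat) : R :=
  if i == 0%N then (if (m %| k)%N then m%:R else 0)
  else (if (m %| k)%N then wheel_eigenvalue R m k else 1) * cas (rim_angle R m k * i%:R).

Lemma cas0 (R : realType) : cas (0 : R) = 1.
Proof. by rewrite /cas cos0 sin0 addr0. Qed.

Lemma sum_cas (R : realType) m k : (0 < m)%N -> (k <= m)%N ->
  \sum_(i < m) cas (rim_angle R m k * i.+1%:R) = if (m %| k)%N then m%:R else 0.
Proof.
move=> m0 km; rewrite /dvdn -[in RHS](mod0n m) -(@sum_cas_cas R m k 0)//.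
by apply: eq_bigr => i _; rewrite /rim_angle mulr0 mul0r mulr0 mul0r cas0 mulr1.
Qed.

Lemma cos_rim_dvd (R : realType) m k : (0 < m)%N -> (m %| k)%N ->
  cos (rim_angle R m k) = 1.
Proof.
move=> m0 /dvdnP[q ->]; have mN0 : m%:R != 0 :> R by rewrite pnatr_eq0 -lt0n.
have -> : rim_angle R m (q * m) = 0 + pi *+ 2 *+ q.
  by rewrite /rim_angle -mulrnA -[in RHS]mulr_natr !natrM; field.
by rewrite (periodicn (@cosD2pi R)) cos0.
Qed.

Lemma cas_dvd (R : realType) m k n : (0 < m)%N -> (m %| k)%N ->
  cas (rim_angle R m k * n%:R) = 1.
Proof.
move=> m0 /dvdnP[q ->].
have -> : rim_angle R m (q * m) * n%:R = 0 + rim_angle R m (q * n) * m%:R.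
  rewrite /rim_angle !natrM; ring.
by rewrite casDperiod// cas0.
Qed.

Lemma sum_delta (R : pzRingType) m a (f : nat -> R) : (0 < a <= m)%N ->
  \sum_(i < m) (i.+1 == a)%:R * f i.+1 = f a.
Proof.
case: a => // a am; rewrite (bigD1 (Ordinal am))//= eqxx mul1r big1 ?addr0// => i ia.
by move: ia; rewrite -val_eqE/= eqSS => /negbTE->; rewrite mul0r.
Qed.

(** The wrap-around between m and 1 is harmless because the [cas] values have period m in the rim
    index. *)
Lemma cas_rim_neighbours (R : realType) m k i : (0 < i <= m)%N ->
  cas (rim_angle R m k * (rim_succ m i)%:R) + cas (rim_angle R m k * (rim_pred m i)%:R)
  = 2 * cos (rim_angle R m k) * cas (rim_angle R m k * i%:R).
Proof.
case/andP => i0 im; have m0 : (0 < m)%N by lia.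
rewrite -cas_neighbours; congr (_ + _).
- rewrite /rim_succ; case: eqP => [->|_]; last by rewrite -natr1 mulrDr mulr1.
  by rewrite mulr1 addrC casDperiod.
- rewrite /rim_pred; case: eqP => [->|_].
    by rewrite mulr1 subrr -[in LHS](add0r (_ * _)) casDperiod.
  by rewrite -[in RHS](prednK i0) -[in RHS]natr1 mulrDr mulr1 addrK.
Qed.

Lemma dvdn_small_eq m k : (0 < m)%N -> (k <= m)%N -> (m %| k)%N = (k == 0)%N || (k == m).
Proof.
move=> m0 km; apply/idP/orP => [/dvdnP[q kE]|[] /eqP->]; rewrite ?dvdn0 ?dvdnn//.
by case: q kE => [|[|q]] kE; [left|right|left]; apply/eqP; nia.
Qed.

Lemma wheel_eigenvectorP (R : realType) m k (i : 'I_m.+1) : (4 <= m)%N -> (k <= m)%N ->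
  \sum_j (ecc_mx R (wheel m.+1) i j : R) * wheel_eigenvector R m k j =
  wheel_eigenvalue R m k * wheel_eigenvector R m k i.
Proof.
move=> m4 km; have m0 : (0 < m)%N by lia.
have kE := dvdn_small_eq m0 km.
(* The row is extended to natural indices so that the rim terms can be read at [j.+1] once the hub
   term is split off. *)
pose entry (j : nat) : R := if i == 0%N :> nat then (j != 0%N)%:R else if j == 0%N then 1
  else 2 - 2 * ((j == i :> nat)%:R + (j == rim_succ m i)%:R + (j == rim_pred m i)%:R).
have entryE (j : 'I_m.+1) : ecc_mx R (wheel m.+1) i j = entry j by exact: ecc_mx_wheelE.
rewrite (eq_bigr (fun j : 'I_m.+1 => entry j * wheel_eigenvector R m k j)); last first.
  by move=> j _; rewrite entryE.
rewrite big_ord_recl; under eq_bigr do rewrite lift0.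
rewrite {entryE}/entry/=.
rewrite /wheel_eigenvector; set c := if _ then wheel_eigenvalue _ _ _ else _.
case: eqVneq => [i0|i0] /=.
  under eq_bigr do rewrite mul1r.
  by rewrite -mulr_sumr sum_cas// mul0r add0r /c; case: ifP => //; rewrite !mulr0.
set t := rim_angle R m k; rewrite mul1r.
(* On the rim, 2 (J - I - C) gives twice the total sum minus twice the terms at i and its two
   neighbours. *)
rewrite (eq_bigr (fun j : 'I_m => 2 * c * cas (t * j.+1%:R) -
    2 * c * ((j.+1 == i :> nat)%:R * cas (t * j.+1%:R)
             + ((j.+1 == rim_succ m i :> nat)%:R * cas (t * j.+1%:R)
                   + (j.+1 == rim_pred m i :> nat)%:R * cas (t * j.+1%:R))))); last first.
  by move=> j _; ring.
have iP : (0 < i <= m)%N by have := ltn_ord i; lia.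
have succP : (0 < rim_succ m i <= m)%N by rewrite /rim_succ; case: ifP; lia.
have predP : (0 < rim_pred m i <= m)%N by rewrite /rim_pred; case: ifP; lia.
rewrite sumrB -!mulr_sumr sum_cas// !big_split/= !(sum_delta (fun j => cas (t * j%:R)))//.
rewrite cas_rim_neighbours// -/t.
rewrite /c; case: ifP => mk.
  rewrite cas_dvd//.
  have -> : cos t = 1 by exact: cos_rim_dvd.
  have: wheel_eigenvalue R m k ^+ 2 = 2 * (m%:R - 3) * wheel_eigenvalue R m k + m%:R.
    by move: mk; rewrite kE /wheel_eigenvalue; case: eqP => _; [|case: eqP => // _];
      rewrite sqr_hub_root.
  by move: (wheel_eigenvalue _ _ _) => x xE; rewrite !mulr1 -expr2 xE; ring.
rewrite /wheel_eigenvalue; move: mk; rewrite kE => /norP[/negbTE-> /negbTE->].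
by rewrite -/t; ring.
Qed.

(** The rim parts are orthogonal unless k and l agree modulo m. For distinct indices this leaves
    only {0, m}, where the hub term m^2 cancels m times the product -m of the two hub roots. *)
Lemma wheel_eigenvector_ortho (R : realType) m k l : (0 < m)%N -> (k <= m)%N -> (l <= m)%N ->
  (\sum_(i < m.+1) wheel_eigenvector R m k i * wheel_eigenvector R m l i == 0) = (k != l).
Proof.
move=> m0 km lm; have mN0 : m%:R != 0 :> R by rewrite pnatr_eq0 -lt0n.
rewrite big_ord_recl; under eq_bigr do rewrite lift0.
rewrite /wheel_eigenvector/=.
set ck := if _ then wheel_eigenvalue _ _ k else _.
set cl := if _ then wheel_eigenvalue _ _ l else _.
under eq_bigr do rewrite mulrACA.
rewrite -mulr_sumr sum_cas_cas//.
case: (boolP (k == l %[mod m])%N) => [kl|klN].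
  have mkl : (m %| k)%N = (m %| l)%N by rewrite /dvdn (eqP kl).
  rewrite /ck /cl mkl; case: ifPn => ml.
  - rewrite -mulrDl mulf_eq0 (negbTE mN0) orbF.
    move: (ml); rewrite -mkl => mk; move: ml mk; rewrite !dvdn_small_eq// /wheel_eigenvalue.
    have mm0 : (m == 0)%N = false by rewrite eqn0Ngt m0.
    have sq0 b : (m%:R + hub_root R m b * hub_root R m b == 0) = false.
      by rewrite gt_eqF// ltr_wpDr ?ltr0n// -expr2 sqr_ge0.
    have pr0 b : (m%:R + hub_root R m b * hub_root R m (~~ b) == 0).
      by rewrite hub_root_mul addrN.
    move=> /orP[] /eqP-> /orP[] /eqP->; rewrite ?eqxx ?mm0 ?sq0//.
    + by rewrite (pr0 true).
    + by rewrite (pr0 false) eq_sym mm0.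
  - have -> : k = l.
      move: kl ml; rewrite dvdn_small_eq// => /eqP kl /norP[l0 lNm].
      have lm' : (l < m)%N by rewrite ltn_neqAle lNm.
      move: mkl; rewrite !dvdn_small_eq// (negbTE l0) (negbTE lNm) => /norP[_ kNm].
      have km' : (k < m)%N by rewrite ltn_neqAle kNm.
      by rewrite -(modn_small km') kl modn_small.
    by rewrite eqxx mulr0 add0r !mul1r (negbTE mN0).
have kNl : k != l by apply: contraNneq klN => ->.
(* For non-congruent k and l at most one is divisible by m, so the product of hub entries
   vanishes. *)
rewrite kNl mulr0 addr0 mulf_eq0; move: klN; rewrite /dvdn.
by case: (eqVneq (k %% m)%N 0%N) => [->|_]; case: (eqVneq (l %% m)%N 0%N) => //= _;
  rewrite ?eqxx ?orbT.
Qed.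

Lemma wheel_char_poly (R : realType) m : (4 <= m)%N ->
  char_poly (ecc_mx R (wheel m.+1)) =
  \prod_(x <- map (wheel_eigenvalue R m) (iota 0 m.+1)) ('X - x%:P).
Proof.
move=> m4; have m0 : (0 < m)%N by lia.
pose P : 'M[R]_m.+1 := \matrix_(i, k) wheel_eigenvector R m k i.
pose d : 'rV[R]_m.+1 := \row_k wheel_eigenvalue R m k.
have PE i k : P i k = wheel_eigenvector R m k i by rewrite mxE.
have dE k : d 0 k = wheel_eigenvalue R m k by rewrite mxE.
rewrite (@char_poly_eigenbasis _ _ _ P d).
- rewrite big_map -/(index_iota 0 m.+1) big_mkord.
  by apply: eq_bigr => k _; rewrite dE.
- apply: unitmx_orthogonal_columns => k l.
  under eq_bigr do rewrite !PE.
  by rewrite wheel_eigenvector_ortho// -ltnS.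
apply/matrixP => i k; rewrite mul_mx_diag [LHS]mxE [RHS]mxE PE dE.
have eigen_ik := @wheel_eigenvectorP R m k i m4 (ltn_ord k).
rewrite [RHS]mulrC -eigen_ik.
by apply: eq_bigr => j _; rewrite PE.
Qed.

(** * Counting signs over the index range *)

Lemma count_iota_itv m a b : (0 < a)%N -> (b <= m)%N ->
  count (fun k => a <= k < b)%N (iota 1 m.-1) = (b - a)%N.
Proof.
move=> a0 bm; case: (leqP a b) => ab; last first.
  by rewrite (eq_count (a2 := pred0)) ?count_pred0 => [|k] /=; lia.
have -> : m.-1 = (a.-1 + ((b - a) + (m - b)))%N by lia.
rewrite !iotaD !count_cat.
rewrite (eq_in_count (a2 := pred0)) => [|k]; last by rewrite mem_iota /=; lia.
rewrite [X in (_ + (X + _))%N](eq_in_count (a2 := predT)) => [|k]; last by rewrite mem_iota /=; lia.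
rewrite [X in (_ + (_ + X))%N](eq_in_count (a2 := pred0)) => [|k]; last by rewrite mem_iota /=; lia.
by rewrite !count_pred0 count_predT size_iota addn0.
Qed.

Lemma count_iota_itvU m a b c d : (0 < a)%N -> (b <= c)%N -> (0 < c)%N ->
  (b <= m)%N -> (d <= m)%N ->
  count (fun k => (a <= k < b) || (c <= k < d))%N (iota 1 m.-1) = ((b - a) + (d - c))%N.
Proof.
move=> a0 bc c0 bm dm; rewrite -(count_iota_itv a0 bm) -(count_iota_itv c0 dm) -count_predUI.
rewrite [X in (_ + X)%N](eq_count (a2 := pred0)) ?count_pred0 ?addn0// => k /=; lia.
Qed.

Theorem theorem4p6 (R : realType) (n : nat) (hn : (5 <= n)%N) :
  inertia (ecc_mx R (wheel n)) =
  (if n %% 3 == 0 then ((n + 3) %/ 3, (2 * n - 3) %/ 3, 0)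
   else if n %% 3 == 1 then ((n - 1) %/ 3, (2 * n - 5) %/ 3, 2)
   else ((n + 1) %/ 3, (2 * n - 1) %/ 3, 0))%N.
Proof.
case: n hn => // m hm; rewrite /inertia !(eigen_countE _ (wheel_char_poly R hm)) !count_map.
have m0 : (0 < m)%N by lia.
(* The end indices 0 and m carry the positive and negative hub roots; the indices in between are the
   rim eigenvalues. *)
have -> : iota 0 m.+1 = (0 :: iota 1 m.-1 ++ [:: m])%N.
  by rewrite /= -[in LHS](prednK m0) -(addn1 m.-1) iotaD add1n prednK.
have hub_gt : 0 < wheel_eigenvalue R m 0.
  by rewrite -sgr_gt0 sgr_hub_root// ltr01.
have hub_lt : wheel_eigenvalue R m m < 0.
  by rewrite /wheel_eigenvalue eqn0Ngt m0 eqxx -sgr_lt0 sgr_hub_root// ltrN10.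
rewrite /= !count_cat /= hub_gt hub_lt
  (lt_gtF hub_gt) (lt_gtF hub_lt) (gt_eqF hub_gt) (lt_eqF hub_lt).
have signs k : k \in iota 1 m.-1 -> [/\ (0 < wheel_eigenvalue R m k) = (m < 3 * k < 2 * m)%N,
    (wheel_eigenvalue R m k < 0) = ((3 * k < m) || (2 * m < 3 * k))%N &
    (wheel_eigenvalue R m k == 0) = ((3 * k == m) || (3 * k == 2 * m))%N].
  rewrite mem_iota => km.
  have [k0 kNm km'] : [/\ k == 0%N = false, k == m = false & (0 < k < m)%N].
    by split; lia.
  by rewrite /wheel_eigenvalue k0 kNm; exact: rim_eigenvalue_sign.
(* The sign conditions become half-open intervals for k: (m + 2) %/ 3 and (2 m + 2) %/ 3 are the
   ceilings of m / 3 and 2 m / 3, and a floor plus one marks the first k strictly beyond. *)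
have posE : {in iota 1 m.-1, preim (wheel_eigenvalue R m) (fun x => 0 < x) =1
    (fun k => (m %/ 3).+1 <= k < (2 * m + 2) %/ 3)%N}.
  by move=> k /signs[/= -> _ _]; clear; lia.
have negE : {in iota 1 m.-1, preim (wheel_eigenvalue R m) (fun x => x < 0) =1
    (fun k => (1 <= k < (m + 2) %/ 3) || (((2 * m) %/ 3).+1 <= k < m))%N}.
  move=> k /[dup] /signs[_ /= -> _]; rewrite mem_iota; clear; lia.
(* Each interval runs from a ceiling to a floor plus one: it is a single point when 3 divides m,
   that is when n is 1 modulo 3, and empty otherwise. *)
have zeroE : {in iota 1 m.-1, preim (wheel_eigenvalue R m) (fun x => x == 0) =1
    (fun k => ((m + 2) %/ 3 <= k < (m %/ 3).+1)
           || ((2 * m + 2) %/ 3 <= k < ((2 * m) %/ 3).+1))%N}.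
  by move=> k /signs[_ _ /= ->]; clear; lia.
rewrite (eq_in_count posE) (eq_in_count negE) (eq_in_count zeroE).
rewrite count_iota_itv ?count_iota_itvU; try lia.
by do !case: ifP; move=> *; congr (_, _, _); lia.
Qed.
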